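(* Let $D=\mathbb{Q}\mathbb{U}_1$ be the rational Urysohn sphere and let $$K(D)=\{f\in[0,1]^D:\ |f(x)-f(y)|\le d(x,y)\le f(x)+f(y)\ \text{for all }x,y\in D\}.$$ Let $A=\{a_0,a_1,a_2\}\subset D$ with $d(a_i,a_j)=1$ for $i\ne j$, and put $r(x)=\min_{0\le i\le 2}d(x,a_i)$ for $x\in D$. Then the function $$g_A(x)=\max\{\tfrac12,1-r(x)\}\qquad(x\in D)$$ is an extreme point of $K(D)$.
   Context: The rational Urysohn sphere $\mathbb{Q}\mathbb{U}_1$ is the (unique up to isometry) countable metric space $(D,d)$ with rational distances, of diameter one, with the following extension property: for every finite $F\subset D$ and every map $p:F\to\mathbb{Q}\cap[0,1]$ with $|p(x)-p(y)|\le d(x,y)\le p(x)+p(y)$ for all $x,y\in F$, there is $z\in D$ with $d(z,x)=p(x)$ for all $x\in F$. $K(D)$ is a compact convex subset of $[0,1]^D$. *)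

(* Defs.v *)
From HB Require Import structures.
From mathcomp Require Import all_boot all_order all_algebra.
From mathcomp Require Import boolp classical_sets functions cardinality.
From mathcomp Require Import reals ereal topology convex interval_inference.

Set Implicit Arguments.
Unset Strict Implicit.
Unset Printing Implicit Defensive.

Import Order.TTheory GRing.Theory Num.Theory.
Local Open Scope classical_set_scope.
Local Open Scope ring_scope.

Definition diameter (R : realType) (D : metricType R) : \bar R :=
  ereal_sup [set z | exists x y : D, z = (mdist x y)%:E].

Definition katetov_on (R : realType) (D : metricType R) (F : set D)
    (f : D -> R) : Prop :=
  forall x y, F x -> F y -> `|f x - f y| <= mdist x y <= f x + f y.

(* The datum p : F -> Q `&` [0, 1] is represented by a total function
   p : D -> R of which only the values on F matter. *)
Definition rational_extension_property (R : realType) (D : metricType R)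
    : Prop :=
  forall (F : set D) (p : D -> R), finite_set F ->
    (forall x, F x -> rational (p x) /\ 0 <= p x <= 1) ->
    katetov_on F p ->
    exists z : D, forall x, F x -> mdist z x = p x.

Record is_rational_urysohn_sphere (R : realType) (D : metricType R) : Prop :=
  IsRationalUrysohnSphere {
    urysohn_countable : countable [set: D];
    urysohn_rational : forall x y : D, rational (mdist x y);
    urysohn_diameter : diameter D = 1%:E;
    urysohn_extension : rational_extension_property D }.

(* K(D), as a subset of the real vector space of all functions D -> R *)
Definition katetov_set (R : realType) (D : metricType R) : set (D -> R^o) :=
  [set f | (forall x, 0 <= f x <= 1) /\ katetov_on [set: D] f].
Arguments katetov_set {R} D.

Definition extreme_point (R : numDomainType) (E : lmodType R) (K : set E)
    (x : E) : Prop :=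
  K x /\ forall (y z : E) (t : R), K y -> K z -> 0 < t < 1 ->
    x = t *: y + (1 - t) *: z -> y = x /\ z = x.

Definition dist_to_triple (R : realType) (D : metricType R) (a : 'I_3 -> D)
    (x : D) : R :=
  \big[Num.min/mdist x (a ord0)]_(i < 3) mdist x (a i).

Definition g_fun (R : realType) (D : metricType R) (a : 'I_3 -> D)
    : D -> R^o :=
  fun x => Num.max (1 / 2) (1 - dist_to_triple a x).

(* Main.v *)
(** Whenever one of the inequalities defining [K(D)] is an equality for [g_A],
    it is an equality for both ends of every segment of [K(D)] through [g_A].
    The constraint [f <= 1] at the [a_i] and the Lipschitz constraint between
    [x] and its nearest [a_i] settle the points with [r x <= 1/2]. If
    [r x >= 1/2], the extension property puts [x] in an equilateral triangle of
    side 1 on which [g_A] is 1/2; the three equations [f u + f v = 1] on its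
    edges force [f x = 1/2]. *)
Require Import Defs.
From HB Require Import structures.
From mathcomp Require Import all_boot all_order all_algebra.
From mathcomp Require Import boolp classical_sets functions cardinality.
From mathcomp Require Import reals ereal topology convex interval_inference.
From mathcomp Require Import lra.

Set Implicit Arguments.
Unset Strict Implicit.
Unset Printing Implicit Defensive.

Import Order.TTheory GRing.Theory Num.Theory.
Local Open Scope classical_set_scope.
Local Open Scope ring_scope.

(** Since [(1 - t) * (v - c)] is nonnegative, [t * (u - c)] cannot be positive. Tight constraints
    pass to the end [u] in this way. *)
Lemma conv_eq_lower_bound (R : realFieldType) (t u v c : R) :
  0 < t < 1 -> c <= u -> c <= v -> t * u + (1 - t) * v = c -> u = c.
Proof.
move=> /andP[t0 t1] cu cv e; apply/eqP; rewrite eq_le cu andbT -subr_le0.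
rewrite -(pmulr_rle0 _ t0).
have : 0 <= (1 - t) * (v - c) by rewrite mulr_ge0 ?subr_ge0 // ltW.
by move: e; lra.
Qed.

Section Triple.
Variables (R : realType) (D : metricType R) (a : 'I_3 -> D).

Lemma dist_to_triple_le (x : D) (i : 'I_3) :
  dist_to_triple a x <= mdist x (a i).
Proof. exact: bigmin_le_cond. Qed.

Lemma dist_to_triple_attained (x : D) :
  exists i, dist_to_triple a x = mdist x (a i).
Proof.
(* The default value of the iterated minimum is itself the distance to [a ord0]. *)
rewrite /dist_to_triple; elim/big_ind: _ => [|u v [i ->] [j ->]|i _].
- by exists ord0.
- by case: leP => _; [exists i | exists j].
- by exists i.
Qed.

Lemma dist_to_triple_lipschitz (x y : D) :
  dist_to_triple a x - dist_to_triple a y <= mdist x y.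
Proof.
have [i ->] := dist_to_triple_attained y.
rewrite lerBlDr (le_trans (dist_to_triple_le x i)) //.
by rewrite metric_triangle.
Qed.

Lemma g_fun_ge_half (x : D) : 1 / 2 <= g_fun a x.
Proof. by rewrite le_max lexx. Qed.

Lemma g_fun_far (x : D) : 1 / 2 <= dist_to_triple a x -> g_fun a x = 1 / 2.
Proof. by move=> rx; apply/max_idPl; move: rx; lra. Qed.

Lemma g_fun_near (x : D) :
  dist_to_triple a x <= 1 / 2 -> g_fun a x = 1 - dist_to_triple a x.
Proof. by move=> rx; apply/max_idPr; move: rx; lra. Qed.

Lemma g_fun_vertex (i : 'I_3) : g_fun a (a i) = 1.
Proof.
have r0 : dist_to_triple a (a i) = 0.
  have [j rj] := dist_to_triple_attained (a i).
  apply/eqP; rewrite eq_le {2}rj mdist_ge0 andbT.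
  by rewrite (le_trans (dist_to_triple_le _ i)) // mdistxx.
by rewrite g_fun_near r0; lra.
Qed.

Lemma g_fun_lipschitz (x y : D) : g_fun a x - g_fun a y <= mdist x y.
Proof.
have := dist_to_triple_lipschitz y x; have := mdist_ge0 x y.
rewrite (metric_sym y x) /g_fun.
by case: (leP (1 / 2)) => ?; case: (leP (1 / 2)) => ?; lra.
Qed.

(** Truncating at 1/2 secures [mdist x y <= g x + g y], as distances are at most 1; the maximum with
    a constant keeps [g] 1-Lipschitz. *)
Lemma g_fun_katetov :
  (forall x y : D, mdist x y <= 1) -> katetov_set D (g_fun a).
Proof.
move=> d1; split=> [x|x y _ _].
  have [i ri] := dist_to_triple_attained x.
  have := mdist_ge0 x (a i); rewrite -ri => r0; apply/andP; split.
    by have := g_fun_ge_half x; lra.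
  by rewrite ge_max; apply/andP; split; move: r0; lra.
apply/andP; split; last first.
  by have := g_fun_ge_half x; have := g_fun_ge_half y; have := d1 x y; lra.
rewrite ler_norml; apply/andP; split; last exact: g_fun_lipschitz.
by have := g_fun_lipschitz y x; rewrite metric_sym; lra.
Qed.

End Triple.

Section Urysohn.
Variables (R : realType) (D : metricType R).
Hypothesis hD : is_rational_urysohn_sphere D.

Lemma urysohn_mdist_le1 (x y : D) : mdist x y <= 1.
Proof.
rewrite -lee_fin -(urysohn_diameter hD); apply: ereal_sup_ubound.
by exists x, y.
Qed.

Lemma urysohn_equidistant (F : set D) : finite_set F ->
  exists z : D, forall x, F x -> mdist z x = 1.
Proof.
move=> finF; apply: (urysohn_extension hD (p := fun=> 1)) => // [x _|x y _ _].
  by split; [by exists 1 => //; exact: rmorph1 | rewrite ler01 lexx].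
rewrite subrr normr0 mdist_ge0 /=.
by have := urysohn_mdist_le1 x y; lra.
Qed.

Lemma g_fun_segment_end (a : 'I_3 -> D) (f h : D -> R^o) (t : R) :
  katetov_set D f -> katetov_set D h -> 0 < t < 1 ->
  g_fun a = t *: f + (1 - t) *: h -> f = g_fun a.
Proof.
move=> [f01 fK] [h01 hK] t01 gE.
have gEx x : t * f x + (1 - t) * h x = g_fun a x by rewrite gE.
have fa i : f (a i) = 1.
  (* Negation turns the upper bound 1 into a lower bound. *)
  suff : - f (a i) = - 1 by lra.
  apply: (@conv_eq_lower_bound _ t _ (- h (a i))) => //.
  - by have := f01 (a i); lra.
  - by have := h01 (a i); lra.
  - by have := gEx (a i); rewrite g_fun_vertex; lra.
have ha i : h (a i) = 1.
  have t'01 : 0 < 1 - t < 1 by move: t01; lra.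
  suff : - h (a i) = - 1 by lra.
  apply: (@conv_eq_lower_bound _ (1 - t) _ (- f (a i))) => //.
  - by have := h01 (a i); lra.
  - by have := f01 (a i); lra.
  - by have := gEx (a i); rewrite g_fun_vertex; lra.
have f_sum x y : g_fun a x = 1 / 2 -> g_fun a y = 1 / 2 -> mdist x y = 1 ->
    f x + f y = 1.
  move=> gx gy dxy; apply: (@conv_eq_lower_bound _ t _ (h x + h y)) => //.
  - by have /andP[_] := fK x y I I; rewrite dxy.
  - by have /andP[_] := hK x y I I; rewrite dxy.
  - by have := gEx x; have := gEx y; rewrite gx gy; lra.
apply/funext => x; have [rx|/ltW rx] := leP (dist_to_triple a x) (1 / 2).
  have [i ri] := dist_to_triple_attained a x.
  (* Both ends are 1-Lipschitz with value 1 at [a i], so both are at least [1 - mdist x (a i)] at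
     [x]. *)
  apply: (@conv_eq_lower_bound _ t _ (h x)); rewrite ?gEx // g_fun_near // ri.
  - have /andP[] := fK x (a i) I I.
    by rewrite fa ler_norml; lra.
  - have /andP[] := hK x (a i) I I.
    by rewrite ha ler_norml; lra.
have fin_a : finite_set (range a) by apply: finite_image; exact: finite_finset.
have far u : (forall i, mdist u (a i) = 1) -> g_fun a u = 1 / 2.
  move=> ua; apply: g_fun_far; have [i ->] := dist_to_triple_attained a u.
  by rewrite ua; lra.
(* Including [range a] in both finite sets puts [u] and [v] at distance 1 from the triple, where
   [g_fun a] is 1/2. *)
have fin1 : finite_set (x |` range a) by rewrite finite_setU; split.
have [u ud] := urysohn_equidistant fin1.
have fin2 : finite_set (u |` (x |` range a)) by rewrite finite_setU; split.
have [v vd] := urysohn_equidistant fin2.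
have gx : g_fun a x = 1 / 2 by exact: g_fun_far.
have gu : g_fun a u = 1 / 2 by apply: far => i; apply: ud; right; exists i.
have gv : g_fun a v = 1 / 2.
  by apply: far => i; apply: vd; right; right; exists i.
have ux := f_sum u x gu gx (ud x (or_introl erefl)).
have vx := f_sum v x gv gx (vd x (or_intror (or_introl erefl))).
have vu := f_sum v u gv gu (vd u (or_introl erefl)).
(* Adding [ux] and [vx] and subtracting [vu] leaves [2 * f x = 1]. *)
by rewrite gx; lra.
Qed.

End Urysohn.

Theorem proposition7p4 (R : realType) (D : metricType R)
    (hD : is_rational_urysohn_sphere D)
    (a : 'I_3 -> D) (ha : forall i j : 'I_3, i != j -> mdist (a i) (a j) = 1) :
  extreme_point (katetov_set D) (g_fun a).
Proof.
split; first by apply: g_fun_katetov; exact: urysohn_mdist_le1.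
move=> y z t yK zK t01 gE; split; first exact: (g_fun_segment_end hD yK zK t01).
(* The other end follows by exchanging [y] with [z] and [t] with [1 - t]. *)
have t'01 : 0 < 1 - t < 1 by move: t01; lra.
apply: (g_fun_segment_end hD zK yK t'01).
by rewrite subKr addrC.
Qed.
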